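(* For every integer $n \ge 15$, the doubly metric dimension of the Johnson graph $J_{n,2}$ is $\psi(J_{n,2}) = \lceil 2n/3 \rceil$.
   Context: The Johnson graph $J_{n,2}$ has as vertices all $2$-element subsets of $[n]=\{1,\dots,n\}$, two being adjacent iff they share exactly one element; $d$ denotes shortest-path distance. Vertices $x,y$ doubly resolve vertices $u,v$ if $d(u,x)-d(u,y)\ne d(v,x)-d(v,y)$. A vertex set $D$ is a doubly resolving set if every two distinct vertices are doubly resolved by some two vertices of $D$; $\psi(G)$ is the minimum cardinality of a doubly resolving set of $G$. *)

(* Defs.v *)
From HB Require Import structures.
From mathcomp Require Import all_boot all_order all_algebra.
Set Implicit Arguments.
Unset Strict Implicit.
Unset Printing Implicit Defensive.
Import Order.TTheory GRing.Theory Num.Theory.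

Section Graph.
Variables (T : finType) (e : rel T).

Definition walkb (x y : T) (k : nat) : bool :=
  [exists p : k.-tuple T, path e x p && (last x p == y)].

(* Shortest-path distance. A shortest path has fewer than #|T| edges, so
   searching k <= #|T| is exhaustive; #|T| is the value on pairs that are not
   connected. *)
Definition gdist (x y : T) : nat :=
  [arg min_(k < (ord_max : 'I_#|T|.+1) | walkb x y k) (k : nat)].

Definition doubly_resolve (x y u v : T) : bool :=
  ((gdist u x)%:Z - (gdist u y)%:Z != (gdist v x)%:Z - (gdist v y)%:Z)%R.

Definition doubly_resolving (D : {set T}) : bool :=
  [forall u : T, forall v : T, (u != v) ==>
     [exists x in D, exists y in D, doubly_resolve x y u v]].

(* The full vertex set is doubly resolving (doubly_resolvingT below), so the
   minimum is over a nonempty family. *)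
Definition psi : nat :=
  #|[arg min_(D < [set: T] | doubly_resolving D) #|D| ]|.

Lemma gdist_walk x p : path e x p -> gdist x (last x p) <= size p.
Proof.
case/shortenP=> p' e_p' Up' sub_p'.
have ltp' : size p' < #|T|.+1.
  by rewrite ltnW // ltnS -[(size p').+1]/(size (x :: p')) -(card_uniqP Up') max_card.
have W : walkb x (last x p') (Ordinal ltp').
  by apply/existsP; exists (in_tuple p'); rewrite e_p' eqxx.
have le1 : gdist x (last x p') <= size p'.
  rewrite /gdist /arg_min /extremum; case: pickP => [k /andP[_ /forallP /(_ (Ordinal ltp'))]|].
    by rewrite W.
  case: (@arg_minnP _ (Ordinal ltp') (fun k : 'I__ => walkb x (last x p') k) (@nat_of_ord _) W)
    => k Pk mk /(_ k) /=.
  by rewrite Pk /= => /forallP[] j; apply/implyP/mk.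
apply: leq_trans le1 _.
by apply: uniq_leq_size => //; case/andP: Up'.
Qed.

Lemma gdist_path x y : connect e x y ->
  exists2 p, path e x p /\ last x p = y & size p = gdist x y.
Proof.
case/connectP=> p /shortenP[p' e_p' Up' _] ->.
have ltp' : size p' < #|T|.+1.
  by rewrite ltnW // ltnS -[(size p').+1]/(size (x :: p')) -(card_uniqP Up') max_card.
have W : walkb x (last x p') (Ordinal ltp').
  by apply/existsP; exists (in_tuple p'); rewrite e_p' eqxx.
set z := last x p' in W *.
rewrite /gdist /arg_min /extremum; case: pickP => [k /andP[/existsP[q /andP[eq /eqP lq]] _]|].
  by exists q; rewrite ?size_tuple.
case: (@arg_minnP _ (Ordinal ltp') (fun k : 'I__ => walkb x z k) (@nat_of_ord _) W)
  => k Pk mk /(_ k) /=.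
by rewrite Pk /= => /forallP[] j; apply/implyP/mk.
Qed.

Lemma gdist_gt0 x y : x != y -> 0 < gdist x y.
Proof.
move=> neq_xy; rewrite lt0n; apply/negP => /eqP d0.
have [c|nc] := boolP (connect e x y).
  case: (gdist_path c) => p [_ lp] /eqP; rewrite d0 size_eq0 => /eqP p0.
  by move: neq_xy; rewrite -lp p0 eqxx.
move: d0; rewrite /gdist /arg_min /extremum; case: pickP => [k|_ /= T0].
  case/andP=> /existsP[q /andP[eq /eqP lq]] _ _.
  by case/negP: nc; apply/connectP; exists q.
by have := card0_eq T0 x.
Qed.

Lemma gdistxx x : gdist x x = 0.
Proof. by apply/eqP; rewrite -leqn0; apply: (@gdist_walk x [::]). Qed.

Lemma doubly_resolvingT : doubly_resolving [set: T].
Proof.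
apply/forallP=> u; apply/forallP=> v; apply/implyP=> neq_uv.
apply/existsP; exists u; rewrite inE; apply/existsP; exists v; rewrite inE /=.
rewrite /doubly_resolve !gdistxx sub0r subr0 eq_sym gt_eqF //.
by rewrite (@lt_le_trans _ _ 0%R) // oppr_lt0 ltz_nat gdist_gt0.
Qed.

Lemma psiP :
  (exists2 D, doubly_resolving D & #|D| = psi) /\
  (forall D, doubly_resolving D -> psi <= #|D|).
Proof.
rewrite /psi; case: arg_minnP => [|D rD minD]; first exact: doubly_resolvingT.
by split; [exists D | exact: minD].
Qed.

End Graph.

Definition johnson2_vertex (n : nat) := {A : {set 'I_n} | #|A| == 2}.

Definition johnson2 (n : nat) : rel (johnson2_vertex n) :=
  fun u v => #|val u :&: val v| == 1.

(* Main.v *)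
(** A pair [u] is at distance [2 - |u ∩ x|] from a pair [x], so a set [D] of
    pairs, seen as the edge set of a graph on [n] points, is doubly resolving
    iff [x |-> |u ∩ x| - |v ∩ x|] is nonconstant on [D] for all pairs [u != v].

    Lower bound.  Resolving [{a, c}] and [{b, c}] shows that some edge separates
    [a] from [b]; hence at most one point is isolated and no edge joins two
    leaves.  If no point is isolated, let each pendant edge give 4 to its leaf
    and 2 to its other end, and let every other edge give 3 to both ends: every
    point receives at least 4, whence [4 n <= 6 |D|].  If [z] is isolated, a
    path [a - b - c] cannot be a component, since [{a, c}] and [{b, z}] would
    not be resolved; distributing 3 + 1 and 2 + 2 instead, every point but [z]
    receives at least 3, whence [3 (n - 1) <= 4 |D|].

    Upper bound.  Take [n %/ 3] disjoint stars covering all points, each with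
    at least two leaves.  There are at least five of them, so two pairs miss a
    star, and the constant difference can only be 0; the only linear relations
    between the incidence vectors of the points of a star forest equate each
    centre with the sum of its leaves, and these do not give a relation between
    two pairs. *)

Require Import Defs.
From mathcomp Require Import all_boot all_order all_algebra.
From mathcomp Require Import zify.

Set Implicit Arguments.
Unset Strict Implicit.
Unset Printing Implicit Defensive.

Lemma cardsI_set2 (T : finType) (a b : T) (X : {set T}) :
  a != b -> #|[set a; b] :&: X| = (a \in X) + (b \in X).
Proof.
move=> ab; rewrite -sum1_card.
rewrite (eq_bigl (fun i => (i \in [set a; b]) && (i \in X))); last first.
  by move=> i; rewrite inE.
rewrite big_mkcondr big_setU1 ?inE //= big_set1.
by case: (a \in X); case: (b \in X).
Qed.

Lemma leq_sum_const (I : finType) (A : {pred I}) (F : I -> nat) (c : nat) :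
  (forall i, i \in A -> c <= F i) -> #|A| * c <= \sum_(i in A) F i.
Proof. by move=> cF; rewrite -sum_nat_const; apply: leq_sum. Qed.

(** * Distances and double resolution through intersections of pairs *)

Section Johnson.
Variable n : nat.
Implicit Types (u v x y : johnson2_vertex n) (a b c : 'I_n).
Implicit Types (D : {set johnson2_vertex n}).

Lemma card_johnson2_vertex x : #|val x| = 2.
Proof. exact/eqP/(valP x). Qed.

Lemma card_johnson2_vertexI x (A : {set 'I_n}) : #|val x :&: A| <= 2.
Proof.
by have := subset_leq_card (subsetIl (val x) A); rewrite card_johnson2_vertex.
Qed.

Lemma johnson2_vertexP x : exists a b, a != b /\ val x = [set a; b].
Proof. exact/cards2P/eqP/card_johnson2_vertex. Qed.

Lemma johnson2_vertex_ex a b : a != b -> exists u, val u = [set a; b].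
Proof.
move=> ab; have ab2 : #|[set a; b]| == 2 by rewrite cards2 ab.
by exists (Sub [set a; b] ab2); rewrite SubK.
Qed.

Lemma johnson2_vertex_set2 x a b :
  a \in val x -> b \in val x -> a != b -> val x = [set a; b].
Proof.
move=> ax bx ab; apply/esym/eqP; rewrite eqEcard card_johnson2_vertex cards2 ab.
by rewrite subUset !sub1set ax bx.
Qed.

(** Disjoint pairs [{a, b}] and [{c, d}] have the common neighbour [{a, c}], and a walk of length 1
    would make them adjacent. *)
Lemma gdist_johnson2 u v : gdist (@johnson2 n) u v = 2 - #|val u :&: val v|.
Proof.
have [<-|uv] := eqVneq u v.
  by rewrite gdistxx setIid card_johnson2_vertex.
have d_gt0 := gdist_gt0 (@johnson2 n) uv.
have [adj|nadj] := boolP (johnson2 u v).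
  have le1 : gdist (@johnson2 n) u v <= 1.
    by apply: (@gdist_walk _ _ u [:: v]); rewrite /= adj.
  by move/eqP: adj => ->; lia.
have I0 : #|val u :&: val v| = 0.
  have le2 := card_johnson2_vertexI u (val v).
  suff /eqP : #|val u :&: val v| != 2 by move/eqP: nadj; lia.
  apply: contra uv => /eqP I2; rewrite -val_eqE eqEsubset.
  have /eqP <- : val u :&: val v == val u.
    by rewrite eqEcard subsetIl I2 card_johnson2_vertex.
  rewrite subsetIr /=.
  by have /eqP-> : val u :&: val v == val v;
     rewrite ?eqEcard ?subsetIr ?I2 ?card_johnson2_vertex.
rewrite I0.
have [a [b [ab ue]]] := johnson2_vertexP u.
have [c [d [cd ve]]] := johnson2_vertexP v.
move/eqP: I0; rewrite ue cardsI_set2 // addn_eq0 !eqb0 ve !inE !negb_or.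
case/andP=> /andP[ac ad] /andP[bc bd].
have [w we] := johnson2_vertex_ex ac.
have uw : johnson2 u w.
  rewrite /johnson2 ue we cardsI_set2 // !inE eqxx /= (eq_sym b a).
  by rewrite (negPf ab) (negPf bc).
have wv : johnson2 w v.
  by rewrite /johnson2 we ve cardsI_set2 // !inE eqxx (negPf ac) (negPf ad).
have /gdist_path[p [pp lp] sp] : connect (@johnson2 n) u v.
  by apply: connect_trans (connect1 uw) (connect1 wv).
have le2 : gdist (@johnson2 n) u v <= 2.
  by apply: (@gdist_walk _ _ u [:: w; v]); rewrite /= uw wv.
suff : size p != 1 by lia.
case: p pp lp {sp} => [|x [|y p]] //= + E; rewrite E.
by rewrite (negPf nadj).
Qed.

(** Intersections have at most 2 points, so no subtraction truncates and the 2's cancel; moving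
    terms across leaves only sums. *)
Lemma doubly_resolve_johnson2 x y u v :
  doubly_resolve (@johnson2 n) x y u v =
  (#|val u :&: val x| + #|val v :&: val y| !=
   #|val u :&: val y| + #|val v :&: val x|).
Proof.
rewrite /doubly_resolve !gdist_johnson2.
have le2 := card_johnson2_vertexI.
move: (le2 u (val x)) (le2 u (val y)) (le2 v (val x)) (le2 v (val y)); lia.
Qed.

Lemma doubly_resolving_johnson2P D :
  reflect (forall u v, u != v -> exists x y, [/\ x \in D, y \in D &
    #|val u :&: val x| + #|val v :&: val y| !=
    #|val u :&: val y| + #|val v :&: val x| ])
  (doubly_resolving (@johnson2 n) D).
Proof.
apply: (iffP forallP) => [rD u v uv|rD u].
  have /forallP/(_ v) := rD u; rewrite uv /= => /existsP[x /andP[xD]].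
  case/existsP=> y /andP[yD]; rewrite doubly_resolve_johnson2 => xy.
  by exists x, y.
apply/forallP=> v; apply/implyP => /rD[x [y [xD yD xy]]].
apply/existsP; exists x; rewrite xD /=; apply/existsP; exists y.
by rewrite yD doubly_resolve_johnson2.
Qed.

(** * Lower bound by discharging from edges to points *)

Section LowerBound.
Hypothesis n_ge3 : 3 <= n.
Variable D : {set johnson2_vertex n}.
Hypothesis rD : doubly_resolving (@johnson2 n) D.

Lemma resolving_neq u v : u != v ->
  exists2 x, x \in D & #|val u :&: val x| != #|val v :&: val x|.
Proof.
case/(doubly_resolving_johnson2P D rD) => x [y [xD yD xy]].
have [E|ne] := eqVneq #|val u :&: val x| #|val v :&: val x|; last by exists x.
by exists y => //; apply: contra xy => /eqP ->; rewrite E addnC.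
Qed.

Lemma resolving_separates a b : a != b ->
  exists2 x, x \in D & (a \in val x) != (b \in val x).
Proof.
(* A third point [c] turns the two points into pairs; its contribution to both intersections is the
   same. *)
move=> ab; have [c ca cb] : exists2 c, c != a & c != b.
  have : 0 < #|~: [set a; b]| by rewrite cardsCs setCK cards2 ab card_ord; lia.
  by case/card_gt0P=> c; rewrite !inE negb_or => /andP[]; exists c.
have [u ue] := johnson2_vertex_ex ca; have [v ve] := johnson2_vertex_ex cb.
have uv : u != v.
  apply/eqP=> E; have : a \in val v by rewrite -E ue !inE eqxx orbT.
  by rewrite ve !inE (negPf ab) eq_sym (negPf ca).
have [x xD ux] := resolving_neq uv; exists x => //; apply: contra ux => /eqP E.
by rewrite ue ve !cardsI_set2 // E.
Qed.

Definition incident a : {set johnson2_vertex n} := [set x in D | a \in val x].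

Lemma isolated_unique a b :
  #|incident a| = 0 -> #|incident b| = 0 -> a = b.
Proof.
move=> /eqP; rewrite cards_eq0 => /eqP a0 /eqP; rewrite cards_eq0 => /eqP b0.
apply/eqP/contraT => /resolving_separates[x xD].
have := in_set0 x; rewrite -{1}a0 inE xD /= => ->.
by have := in_set0 x; rewrite -{1}b0 inE xD /= => ->.
Qed.

Lemma leaf_incident a x y : #|incident a| = 1 ->
  x \in D -> a \in val x -> y \in D -> (a \in val y) = (y == x).
Proof.
move/eqP/cards1P=> [z az] xD ax yD.
have : x \in incident a by rewrite inE xD.
by rewrite az inE => /eqP ->; rewrite -in_set1 -az inE yD.
Qed.

Lemma leaf_neighbour a b x : x \in D -> a \in val x -> b \in val x ->
  #|incident a| = 1 -> #|incident b| = 1 -> a = b.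
Proof.
move=> xD ax bx a1 b1; apply/eqP/contraT => /resolving_separates[y yD].
by rewrite (leaf_incident a1 xD ax yD) (leaf_incident b1 xD bx yD) eqxx.
Qed.

Definition pendant x := [exists a in val x, #|incident a| == 1].

(** For an end [a] of [x]: [p] if [a] is a leaf, [q] if the other end is, [r] if neither. The
    parameters cover both discharging rules. *)
Definition charge (p q r : nat) x a :=
  if #|incident a| == 1 then p else if pendant x then q else r.

Lemma charge_edge p q r x : p + q = 2 * r -> x \in D ->
  \sum_(a in val x) charge p q r x a = 2 * r.
Proof.
move=> pqr xD; have [a [b [ab xe]]] := johnson2_vertexP x.
have ax : a \in val x by rewrite xe !inE eqxx.
have bx : b \in val x by rewrite xe !inE eqxx orbT.
rewrite xe big_setU1 ?inE //= big_set1 /charge.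
have [a1|a1] := eqVneq #|incident a| 1; have [b1|b1] := eqVneq #|incident b| 1.
- by have := leaf_neighbour xD ax bx a1 b1 => E; rewrite E eqxx in ab.
- have -> : pendant x by apply/existsP; exists a; rewrite ax a1.
  by [].
- have -> : pendant x by apply/existsP; exists b; rewrite bx b1.
  by rewrite addnC.
have /negPf-> : ~~ pendant x; last by lia.
apply/existsP=> -[c]; rewrite xe !inE => /andP[/orP[]/eqP->];
  by rewrite ?(negPf a1) ?(negPf b1).
Qed.

Lemma charge_total p q r : p + q = 2 * r ->
  \sum_a \sum_(x in incident a) charge p q r x a = 2 * r * #|D|.
Proof.
move=> pqr; rewrite (exchange_big_dep (mem D)) /=; last first.
  by move=> a x _; rewrite inE => /andP[].
under eq_bigr => x xD.
  under eq_bigl => a do rewrite inE xD.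
  rewrite (charge_edge pqr xD); over.
by rewrite sum_nat_const mulnC.
Qed.

Lemma charge_leaf p q r a : #|incident a| = 1 ->
  \sum_(x in incident a) charge p q r x a = p.
Proof.
by move=> a1; rewrite /charge a1 eqxx sum_nat_const a1 mul1n.
Qed.

Lemma charge_ge p q r x a : q <= p -> q <= r -> q <= charge p q r x a.
Proof. by move=> qp qr; rewrite /charge; case: ifP => // _; case: ifP. Qed.

Lemma card_ge_no_isolated :
  (forall a, 0 < #|incident a|) -> 2 * n <= 3 * #|D|.
Proof.
move=> iso; have tot := @charge_total 4 2 3 erefl.
suff : #|'I_n| * 4 <= 2 * 3 * #|D| by rewrite card_ord; lia.
rewrite -tot; apply: leq_sum_const => a _.
have [a1|a1] := eqVneq #|incident a| 1; first by rewrite charge_leaf.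
(* A point that is not a leaf has at least two edges, each giving at least 2. *)
have : #|incident a| * 2 <= \sum_(x in incident a) charge 4 2 3 x a.
  by apply: leq_sum_const => x _; apply: charge_ge.
by have := iso a; lia.
Qed.

(** With leaves [a] in [x] and [c] in [y], the pairs [{a, c}] and [{b, z}] both meet [x] and [y]
    once and miss every other edge of [D]. *)
Lemma no_path3_component z b x y : #|incident z| = 0 ->
  x != y -> incident b = [set x; y] -> pendant x -> pendant y -> False.
Proof.
move=> z0 xy bxy /existsP[a /andP[ax /eqP a1]] /existsP[c /andP[cy /eqP c1]].
have b2 : #|incident b| = 2 by rewrite bxy cards2 xy.
have zx t : t \in D -> z \notin val t.
  by move=> tD; have := card0_eq z0 t; rewrite inE tD /= => ->.
have : x \in incident b by rewrite bxy !inE eqxx.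
rewrite inE => /andP[xD bx].
have : y \in incident b by rewrite bxy !inE eqxx orbT.
rewrite inE => /andP[yD by'].
have ab : a != b by apply/eqP=> E; rewrite -E a1 in b2.
have cb : c != b by apply/eqP=> E; rewrite -E c1 in b2.
have ac : a != c.
  apply: contra xy => /eqP E; rewrite -val_eqE /=.
  by rewrite (johnson2_vertex_set2 ax bx ab) (johnson2_vertex_set2 cy by' cb) E.
have bz : b != z by apply/eqP=> E; rewrite E z0 in b2.
have [u ue] := johnson2_vertex_ex ac; have [v ve] := johnson2_vertex_ex bz.
have uv : u != v.
  apply/eqP=> E; have : b \in val u by rewrite E ve !inE eqxx.
  by rewrite ue !inE eq_sym (negPf ab) eq_sym (negPf cb).
have [t tD] := resolving_neq uv.
rewrite ue ve !cardsI_set2 // (negPf (zx _ tD)).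
rewrite (leaf_incident a1 xD ax tD) (leaf_incident c1 yD cy tD).
have -> : (b \in val t) = (t == x) || (t == y).
  by rewrite -in_set2 -bxy inE tD.
have [->|_] := eqVneq t x; first by rewrite (negPf xy).
by case: (t == y).
Qed.

Lemma card_ge_isolated z :
  #|incident z| = 0 -> 3 * n.-1 <= 4 * #|D|.
Proof.
move=> z0; have tot := @charge_total 3 1 2 erefl.
suff : #|predC1 z| * 3 <= 2 * 2 * #|D|.
  have := cardC1 z; rewrite card_ord => ->; lia.
rewrite -tot (bigD1 z) //=; apply: leq_trans (leq_addl _ _).
apply: (@leq_sum_const _ (predC1 z)) => a az.
have a_gt0 : 0 < #|incident a|.
  rewrite lt0n; apply: contra az => /eqP a0.
  by apply/eqP/isolated_unique.
have [a1|a1] := eqVneq #|incident a| 1; first by rewrite charge_leaf.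
have [a2|a2] := eqVneq #|incident a| 2; last first.
  apply: (@leq_trans (#|incident a| * 1)); first by lia.
  by apply: leq_sum_const => x _; apply: charge_ge.
have /cards2P[x [y [xy axy]]] : #|incident a| == 2 by rewrite a2.
rewrite axy big_setU1 ?inE //= big_set1 /charge a2 /=.
(* Degree 2 yields at least 1 + 2 unless both edges are pendant, which would be a path component. *)
case px: (pendant x); case py: (pendant y) => //.
by case: (no_path3_component z0 xy axy px py).
Qed.

Lemma doubly_resolving_card : 9 <= n -> 2 * n <= 3 * #|D|.
Proof.
move=> n9; have [/existsP[z /eqP z0]|] := boolP [exists z, #|incident z| == 0].
  (* Here [9 (n - 1) >= 8 n] is needed, which is where [9 <= n] enters. *)
  by have := card_ge_isolated z0; lia.
rewrite negb_exists => /forallP iso; apply: card_ge_no_isolated => a.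
by rewrite lt0n iso.
Qed.

End LowerBound.

(** * Upper bound from a spanning star forest *)

Section UpperBound.
Variable k : nat.
Hypotheses (k_ge5 : 5 <= k) (k3n : 3 * k <= n).

(* The points below [k] are the centres of the stars. *)
Definition centre a : 'I_n := Ordinal (leq_ltn_trans (leq_mod a k) (ltn_ord a)).

(** Each point from [k] on is joined to its residue modulo [k]; as [3 * k <= n], the centre [t] has
    at least the leaves [t + k] and [t + 2 * k]. *)
Definition star_forest : {set johnson2_vertex n} :=
  [set x | val x \in [set [set j; centre j] | j in [set j : 'I_n | k <= j]]].

Lemma star_forest_card : #|star_forest| <= n - k.
Proof.
rewrite -(card_imset _ val_inj).
apply: (@leq_trans #|[set [set j; centre j] | j in [set j : 'I_n | k <= j]]|).
  by apply/subset_leq_card/subsetP=> s /imsetP[x]; rewrite inE => + ->.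
apply: leq_trans (leq_imset_card _ _) _.
rewrite cardsE -sum1_card -(big_geq_mkord _ _ predT (fun=> 1)).
by rewrite sum_nat_const_nat muln1.
Qed.

Lemma centre_lt a : centre a < k.
Proof. by rewrite /= ltn_mod; lia. Qed.

Lemma centre_neq a : k <= a -> a != centre a.
Proof.
by move=> ka; apply: contraL ka => /eqP ->; rewrite -ltnNge centre_lt.
Qed.

Lemma star_forest_edge a : k <= a ->
  exists2 x, x \in star_forest & forall u : {set 'I_n},
    #|u :&: val x| = (a \in u) + (centre a \in u).
Proof.
move=> ka; have [x xe] := johnson2_vertex_ex (centre_neq ka); exists x.
  by rewrite inE xe; apply/imsetP; exists a; rewrite ?inE.
by move=> u; rewrite setIC xe cardsI_set2 // centre_neq.
Qed.

(** By pigeonhole some residue [i] modulo [k] does not occur in [A]; the edge from [i] to [i + k]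
    then misses [A]. *)
Lemma star_forest_missed (A : {set 'I_n}) : #|A| < k ->
  exists2 a : 'I_n, k <= a & (a \notin A) && (centre a \notin A).
Proof.
move=> Ak.
have ltk2 (i : 'I_k) : i + k < n by have := ltn_ord i; lia.
pose s a : 'I_k := Ordinal (centre_lt a).
have : 0 < #|~: (s @: A)|.
  rewrite cardsCs setCK card_ord subn_gt0.
  by rewrite (leq_ltn_trans (leq_imset_card _ _)).
case/card_gt0P=> i; rewrite inE => /negP iA.
have modi : i %% k = i by rewrite modn_small.
exists (Ordinal (ltk2 i)); first by rewrite /=; lia.
apply/andP; split; apply/negP => inA; apply: iA; apply/imsetP.
  by exists (Ordinal (ltk2 i)) => //; apply: val_inj; rewrite /= modnDr modi.
exists (centre (Ordinal (ltk2 i))) => //.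
by apply: val_inj; rewrite /= modnDr !modi.
Qed.

Section Relation.
Variables (u v : {set 'I_n}).
Hypotheses (u2 : #|u| = 2) (v2 : #|v| = 2).
Hypothesis uv : forall a, k <= a ->
  (a \in u) + (centre a \in u) = (a \in v) + (centre a \in v).

Lemma star_relation_leaf a : k <= a -> centre a \in u -> centre a \notin v ->
  (a \in v) && (a \notin u).
Proof.
by move=> /uv + cu /negPf cv; rewrite cu cv; case: (a \in u); case: (a \in v).
Qed.

(** If [t] is not in [v], its edges force two of its leaves into [v], which fills [v]. The second
    point [b] of [u] then has no counterpart. *)
Lemma star_relation_centre (t : 'I_n) : t < k -> t \in u -> t \in v.
Proof.
move=> tk tu; apply: contraT => tv.
have lt1 : t + k < n by lia.
have lt2 : t + 2 * k < n by lia.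
pose l1 := Ordinal lt1; pose l2 := Ordinal lt2.
have c1 : centre l1 = t by apply: val_inj; rewrite /= modnDr modn_small.
have c2 : centre l2 = t.
  by apply: val_inj; rewrite /= addnC modnMDl modn_small.
have /andP[l1v l1u] : (l1 \in v) && (l1 \notin u).
  by apply: star_relation_leaf; rewrite ?c1 //=; lia.
have /andP[l2v l2u] : (l2 \in v) && (l2 \notin u).
  by apply: star_relation_leaf; rewrite ?c2 //=; lia.
have l12 : l1 != l2 by rewrite -val_eqE /=; lia.
have ve : v = [set l1; l2].
  by apply/esym/eqP; rewrite eqEcard v2 cards2 l12 subUset !sub1set l1v l2v.
have small (b : 'I_n) : b < k -> b \notin v.
  by rewrite ve !inE -!val_eqE /=; lia.
have [b bt bu] : exists2 b, b != t & b \in u.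
  have : 0 < #|u :\ t| by move: u2; rewrite (cardsD1 t) tu add1n => -[->].
  by case/card_gt0P=> b; rewrite !inE => /andP[]; exists b.
(* A centre [b] would force its own leaf [b + k] into [v]; a leaf [b] lies on an edge that [v]
   misses. *)
have [bk|kb] := ltnP b k.
  have lt3 : b + k < n by lia.
  have c3 : centre (Ordinal lt3) = b.
    by apply: val_inj; rewrite /= modnDr modn_small.
  have /andP[] : (Ordinal lt3 \in v) && (Ordinal lt3 \notin u).
    by apply: star_relation_leaf; rewrite ?c3 ?small //=; lia.
  by move: bt; rewrite ve !inE -!val_eqE /=; lia.
have := uv kb; rewrite bu (negPf (small _ (centre_lt b))).
suff /negPf-> : b \notin v by [].
by apply: contraL bu; rewrite ve !inE => /orP[]/eqP->.
Qed.

End Relation.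

Lemma star_relation (u v : {set 'I_n}) : #|u| = 2 -> #|v| = 2 ->
  (forall a, k <= a ->
     (a \in u) + (centre a \in u) = (a \in v) + (centre a \in v)) -> u = v.
Proof.
move=> u2 v2 uv.
have eq_centre (t : 'I_n) : t < k -> (t \in u) = (t \in v).
  move=> tk; apply/idP/idP; apply: star_relation_centre => // a ka.
  by rewrite uv.
apply/setP=> a; have [/eq_centre //|/uv] := ltnP a k.
rewrite (eq_centre _ (centre_lt a)) => /addIn.
by case: (a \in u); case: (a \in v).
Qed.

Lemma star_forest_doubly_resolving :
  doubly_resolving (@johnson2 n) star_forest.
Proof.
apply/doubly_resolving_johnson2P => u v uv.
have [//|const] := boolP [exists x in star_forest, exists y in star_forest,
    #|val u :&: val x| + #|val v :&: val y| !=
    #|val u :&: val y| + #|val v :&: val x|].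
  by case/existsP=> x /andP[xD] /existsP[y /andP[yD]]; exists x, y.
case/eqP: uv; apply: val_inj.
apply: star_relation; rewrite ?card_johnson2_vertex //.
move=> a /star_forest_edge[x xD xE].
(* The union has at most 4 < [k] points, so some edge [y] misses both pairs; comparison with [y]
   makes the constant difference 0. *)
have [|b /star_forest_edge[y yD yE]] := @star_forest_missed (val u :|: val v).
  by have := cardsU (val u) (val v); rewrite !card_johnson2_vertex; lia.
rewrite !inE !negb_or => /andP[/andP[bu bv] /andP[cu cv]].
move: const; rewrite negb_exists => /forallP/(_ x); rewrite xD negb_exists /=.
move=> /forallP/(_ y); rewrite yD negbK /= !xE !yE.
by rewrite (negPf bu) (negPf bv) (negPf cu) (negPf cv) addn0 => /eqP.
Qed.

End UpperBound.

End Johnson.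

(** * The exact value and its form as a ceiling *)

Lemma psi_johnson2 n : 15 <= n -> psi (@johnson2 n) = n - n %/ 3.
Proof.
move=> n15; have [[D rD cD] psi_min] := psiP (@johnson2 n).
have low := doubly_resolving_card (ltac:(lia) : 3 <= n) rD.
have k5 : 5 <= n %/ 3 by lia.
have k3 : 3 * (n %/ 3) <= n by lia.
have := leq_trans (psi_min _ (star_forest_doubly_resolving k5 k3))
                  (star_forest_card n (n %/ 3)).
(* By integrality, [2 * n <= 3 * psi] already gives [n - n %/ 3 <= psi]. *)
by move: low; rewrite cD; lia.
Qed.

Lemma ceil_two_thirds n :
  Num.ceil ((2 * n)%N%:R / 3%:R : rat)%R = Posz (n - n %/ 3).
Proof.
(* With [m] the claimed value, this amounts to [3 (m - 1) < 2 n <= 3 m]. *)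
apply: Num.Theory.ceil_def; rewrite Num.Theory.ltr_pdivlMr //.
rewrite Num.Theory.ler_pdivrMr // -[3%:R%R]/(3%:~R)%R.
rewrite -[(2 * n)%N%:R%R]/((2 * n)%N%:~R)%R -!intrM ltr_int ler_int; lia.
Qed.

Theorem theorem7 (n : nat) (hn : (15 <= n)%N) :
  Posz (psi (@johnson2 n)) = Num.ceil ((2 * n)%N%:R / 3%:R : rat)%R.
Proof. by rewrite psi_johnson2 // ceil_two_thirds. Qed.
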